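(* Let $p>2$ be a prime, and let $\varphi\in\mathbb{C}^{\{1,\ldots,p-1\}}$ be given by $\varphi(1)=1$, $\varphi(2)=2$ in the case $p=3$, and by $\varphi(m)=1-\delta_1(m)$ for $m\in\{1,\ldots,p-1\}$ in the case $p>3$ (that is, $\varphi(1)=0$ and $\varphi(m)=1$ for $m\ne 1$). Then the system $\widehat{\pi}_0(G)\varphi=(\widehat{\pi}_0(k,l)\varphi)_{(k,l)\in G}$ does matrix recovery on $\mathbb{C}^{\{1,\ldots,p-1\}}$.
   Context: All arithmetic on indices in $\{0,1,\ldots,p-1\}$ is in the field $\mathbb{Z}_p=\mathbb{Z}/p\mathbb{Z}$, and $\mathbb{Z}_p^*=\mathbb{Z}_p\setminus\{0\}$ is the multiplicative group. $G=\mathbb{Z}_p\rtimes\mathbb{Z}_p^*$ is the affine group: the set $\mathbb{Z}_p\times\mathbb{Z}_p^*$ with group law $(k,l)(k',l')=(k+lk',ll')$. The unitary representation $\widehat{\pi}_0$ of $G$ acts on $\mathbb{C}^{\{1,\ldots,p-1\}}$ by $(\widehat{\pi}_0(k,l)f)(m)=e^{-2\pi ikm/p}f(lm)$. A system $(\psi_i)_{i\in I}$ of vectors in a finite-dimensional complex Hilbert space $\mathcal{H}$ does matrix recovery if the linear map $A\mapsto(\langle A\psi_i,\psi_i\rangle)_{i\in I}$ from the space $\mathcal{L}(\mathcal{H})$ of linear maps $\mathcal{H}\to\mathcal{H}$ to $\mathbb{C}^I$ is one-to-one. *)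

(* Defs.v *)
From HB Require Import structures.
From mathcomp Require Import all_boot all_order all_algebra all_fingroup.
From mathcomp Require Import sesquilinear.
From mathcomp Require Import complex.
From mathcomp Require Import reals trigo.

Set Implicit Arguments.
Unset Strict Implicit.
Unset Printing Implicit Defensive.

Import Order.TTheory GRing.Theory Num.Theory Num.Def.
Local Open Scope ring_scope.

(* A finite-dimensional complex Hilbert space is a [vectType] together with a
   positive definite Hermitian form, linear in its first argument. *)
Definition does_matrix_recovery (C : numClosedFieldType) (H : vectType C)
    (dot : {dot H for conjC}) (I : Type) (psi : I -> H) : Prop :=
  injective (fun (A : 'End(H)) (i : I) => dot (A (psi i)) (psi i)).

Section InnerProduct.
Variables (C : numClosedFieldType) (M : finType).
Implicit Types (a : C) (f g h : {ffun M -> C^o}).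

Definition ffun_dot f g : C := \sum_m f m * (g m)^*.

Fact ffun_dot_linearl g : linear_for *%R (ffun_dot^~ g).
Proof.
move=> a f h; rewrite /ffun_dot mulr_sumr -big_split /=.
by apply: eq_bigr => m _; rewrite !ffunE mulrDl mulrA.
Qed.

Fact ffun_dot_linearr f : linear_for (conjC \; *%R) (ffun_dot f).
Proof.
move=> a g h; rewrite /ffun_dot /= mulr_sumr -big_split /=.
by apply: eq_bigr => m _; rewrite !ffunE rmorphD rmorphM mulrDr mulrCA.
Qed.

HB.instance Definition _ :=
  bilinear_isBilinear.Build C {ffun M -> C^o} {ffun M -> C^o} C
    *%R (conjC \; *%R) ffun_dot (ffun_dot_linearl, ffun_dot_linearr).

Fact ffun_dot_herm f g :
  ffun_dot f g = (-1) ^+ false * (ffun_dot g f)^*.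
Proof.
rewrite expr0 mul1r /ffun_dot rmorph_sum; apply: eq_bigr => m _.
by rewrite rmorphM /= conjCK mulrC.
Qed.

HB.instance Definition _ :=
  isHermitianSesquilinear.Build C {ffun M -> C^o} false conjC ffun_dot
    ffun_dot_herm.

Fact ffun_dot_gt0 f : f != 0 -> 0 < ffun_dot f f.
Proof.
move=> f_neq0; rewrite lt_def sumr_ge0 => [|m _]; last exact: mul_conjC_ge0.
rewrite andbT; apply: contra f_neq0 => /eqP dot0; apply/eqP/ffunP => m.
have /eqP := @psumr_eq0P _ _ _ _ (fun m _ => mul_conjC_ge0 (f m)) dot0 m isT.
by rewrite mul_conjC_eq0 ffunE => /eqP.
Qed.

HB.instance Definition _ :=
  isDotProduct.Build C {ffun M -> C^o} ffun_dot ffun_dot_gt0.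

End InnerProduct.

(* For p prime, 'F_p is Z/pZ and {unit 'F_p} its multiplicative group. *)
Definition affine (p : nat) : Type := ('F_p * {unit 'F_p})%type.

Section AffineGroup.
Variable p : nat.
Implicit Types x y z : affine p.

HB.instance Definition _ := Finite.copy (affine p) ('F_p * {unit 'F_p})%type.

Definition affine_mul x y : affine p := (x.1 + val x.2 * y.1, (x.2 * y.2)%g).
Definition affine_one : affine p := (0, 1%g).
Definition affine_inv x : affine p := (- (val (x.2^-1)%g * x.1), (x.2^-1)%g).

Fact affine_mulA : associative affine_mul.
Proof.
move=> x y z; congr pair; last exact: mulgA.
by rewrite /= mulrDr addrA mulrA.
Qed.

Fact affine_mul1 : left_id affine_one affine_mul.
Proof.
by move=> [k l]; rewrite /affine_mul /= mul1g add0r mul1r.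
Qed.

Fact affine_mulV : left_inverse affine_one affine_inv affine_mul.
Proof.
by move=> [k l]; rewrite /affine_mul /= mulVg addNr.
Qed.

HB.instance Definition _ :=
  Finite_isGroup.Build (affine p) affine_mulA affine_mul1 affine_mulV.

End AffineGroup.

Section Representation.
Variables (R : realType) (p : nat).
Local Open Scope complex_scope.

(* e ^ (i t), by Euler's formula *)
Definition expi (t : R) : R[i] := cos t +i* sin t.

(* {1, ..., p - 1} is identified with the nonzero residues mod p. *)
Definition Cvec : vectType R[i] := {ffun {unit 'F_p} -> R[i]^o}.

Definition Cdot : {dot Cvec for conjC} :=
  @ffun_dot R[i] {unit 'F_p}.

(* [nat_of_ord] is the representative in 0, ..., p - 1 of a residue mod p. *)
Definition pi0 (x : affine p) (f : Cvec) : Cvec :=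
  [ffun m : {unit 'F_p} =>
    expi (- (2 * pi * (nat_of_ord (x.1 * val m))%:R / p%:R)) * f (x.2 * m)%g].

Fact expiD s t : expi (s + t) = expi s * expi t.
Proof. by rewrite /expi cosD sinD; congr Complex; rewrite addrC. Qed.

Fact expi_conj t : expi t * (expi t)^* = 1.
Proof.
have mulNr' (a b : R) : a * - b = - (a * b) by rewrite mulrN.
apply/eqP; rewrite eq_complex /= !mulNr' opprK -!expr2 cos2Dsin2 eqxx /=.
by rewrite mulrC addNr.
Qed.

Fact expi_modp (n : nat) :
  prime p ->
  expi (- (2 * pi * (n %% p)%:R / p%:R)) = expi (- (2 * pi * n%:R / p%:R)).
Proof.
move=> p_pr; have p_neq0 : p%:R != 0 :> R by rewrite pnatr_eq0 -lt0n prime_gt0.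
have -> : 2 * pi * n%:R / p%:R =
    2 * pi * (n %% p)%:R / p%:R + pi *+ 2 *+ (n %/ p) :> R.
  rewrite {1}(divn_eq n p) natrD natrM mulrDr mulrDl addrC mulrA mulfK //.
  by congr +%R; rewrite -[RHS]mulr_natr -[pi *+ 2]mulr_natl.
by rewrite /expi !cosN !sinN (periodicn (@cosD2pi R)) (periodicn (@sinD2pi R)).
Qed.

Fact pi0_linear x : linear (pi0 x).
Proof.
by move=> a f g; apply/ffunP => m; rewrite !ffunE mulrDr; congr +%R;
  rewrite mulrCA.
Qed.

Fact pi0_one f : pi0 1%g f = f.
Proof.
rewrite -[1%g]/(affine_one p); apply/ffunP => m; rewrite !ffunE.
rewrite [_.1]/(0 : 'F_p) [_.2]/(1%g : {unit 'F_p}) mul1g.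
by rewrite mul0r (_ : nat_of_ord 0 = 0%N) // mulr0 mul0r oppr0 /expi cos0 sin0 mul1r.
Qed.

Fact pi0_mul x y f : prime p -> pi0 (x * y)%g f = pi0 x (pi0 y f).
Proof.
move=> p_pr; rewrite -[(x * y)%g]/(affine_mul x y).
apply/ffunP => m; rewrite !ffunE mulrA -expiD; congr (_ * f _); last first.
  rewrite [_.2]/(x.2 * y.2)%g mulgA; congr (_ * _)%g.
  by apply/val_inj; rewrite /= mulrC.
rewrite -opprD -mulrDl -mulrDr -natrD -[RHS]expi_modp //.
have natD (a b : 'F_p) : nat_of_ord (a + b) = ((a + b)%N %% p)%N.
  by congr (_ %% _)%N; apply: Fp_cast.
rewrite -natD; congr (expi (- (_ * (nat_of_ord _)%:R / _))).
by rewrite [LHS]mulrDl -[val (x.2 * m)%g]/(val x.2 * val m) mulrA [y.1 * _]mulrC.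
Qed.

Fact pi0_unitary x f g : Cdot (pi0 x f) (pi0 x g) = Cdot f g.
Proof.
rewrite /Cdot /= /ffun_dot [RHS](reindex_inj (mulgI x.2)) /=.
apply: eq_bigr => m _; rewrite !ffunE rmorphM mulrACA expi_conj mul1r //.
Qed.

Definition phi : Cvec :=
  [ffun m : {unit 'F_p} =>
    if p == 3%N then (if val m == 1 then 1 else 2)
    else (if val m == 1 then 0 else 1)].

End Representation.

(* Main.v *)
(** For the matrix [a m n] of [A], the measurement at [(k, l)] is the sum of
    [a m n * chi (k * (n - m)) * phi (l n) * phi (l m)], with [chi] a
    nontrivial additive character. Fourier inversion in [k] isolates each
    diagonal [m = n + d]. Now [phi] is [c] minus the indicator of [1], with
    [c = 2] if [p = 3] and [c = 1] otherwise. So, with [s = l^-1], the entries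
    [b n = a (n + d) n] of a diagonal, extended by [0] and of sum [T], satisfy
    [b (s - d) + b s = c T] for all nonzero [s] if [d <> 0], and
    [(2 c - 1) b s = c ^ 2 T] if [d = 0]. Summing over [s] gives
    [2 T = c (p - 1) T], resp. [(2 c - 1) T = c ^ 2 (p - 1) T], so [T = 0];
    then [b] vanishes along the progression [0, d, 2 d, ...], resp. pointwise. *)
Require Import Defs.
From mathcomp Require Import all_boot all_order all_algebra all_fingroup.
From mathcomp Require Import complex reals.
From mathcomp Require Import trigo ring.

Set Implicit Arguments.
Unset Strict Implicit.
Unset Printing Implicit Defensive.

Import Order.TTheory GRing.Theory Num.Theory.
Local Open Scope ring_scope.

(** * Functional equations on the prime field *)

Section PrimeFieldSums.
Variables (C : numFieldType) (p : nat).
Hypothesis p_prime : prime p.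
Implicit Types (b : 'F_p -> C) (d s x : 'F_p).

Lemma card_Fp_neq0 : #|[pred x : 'F_p | x != 0]| = p.-1.
Proof.
apply: succn_inj; rewrite prednK ?prime_gt0 //.
apply: etrans (card_Fp p_prime); rewrite [RHS](cardD1 0); congr _.+1.
by apply: eq_card => x; rewrite !inE andbT.
Qed.

Lemma sum_Fp_neq0 b : \sum_(x | x != 0) b x = \sum_x b x - b 0.
Proof. by rewrite [in RHS](bigD1 0) //= addrAC subrr add0r. Qed.

Lemma sum_Fp_neq0_const (t : C) : \sum_(x : 'F_p | x != 0) t = t *+ p.-1.
Proof. by rewrite big_const iter_addr_0 card_Fp_neq0. Qed.

Lemma vanish_of_const b (c e : nat) :
    (0 < e)%N -> (c * p.-1)%N <> e -> b 0 = 0 ->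
    (forall s, s != 0 -> b s * e%:R = (\sum_x b x) * c%:R) ->
  forall x, b x = 0.
Proof.
move=> e_gt0 ce_neq b0 bE.
have T0 : \sum_x b x = 0.
  (* In characteristic 0, a nonzero sum could be cancelled from the summed relation, leaving the
     excluded equality of naturals. *)
  apply/eqP; apply: contra_notT ce_neq => /mulrIn; apply.
  rewrite mulrnA -sum_Fp_neq0_const -mulr_natr -(eq_bigr _ bE) -mulr_suml.
  by rewrite sum_Fp_neq0 b0 subr0 mulr_natr.
move=> x; have [->//|/bE/eqP] := eqVneq x 0.
by rewrite T0 mul0r mulf_eq0 pnatr_eq0 gtn_eqF // orbF => /eqP.
Qed.

Lemma vanish_of_pairs b (c : nat) d :
    (c * p.-1)%N <> 2%N -> d != 0 -> b 0 = 0 -> b (- d) = 0 ->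
    (forall s, s != 0 -> b (s - d) + b s = (\sum_x b x) * c%:R) ->
  forall x, b x = 0.
Proof.
move=> c_neq d_neq0 b0 bNd bE.
have T0 : \sum_x b x = 0.
  apply/eqP; apply: contra_notT c_neq => /mulrIn; apply.
  rewrite mulrnA -sum_Fp_neq0_const -mulr_natr -(eq_bigr _ bE) big_split /=.
  (* The terms omitted at [s = 0] are [b (- d)] and [b 0], both zero, so each of the two sums is the
     full one. *)
  rewrite (sum_Fp_neq0 (fun s => b (s - d))) sum_Fp_neq0 sub0r.
  rewrite bNd b0 !subr0 mulr2n; congr (_ + _).
  by rewrite [RHS](reindex_inj (addIr (- d))).
have bj (j : nat) : b (j%:R * d) = 0.
  elim: j => [|j IHj]; first by rewrite mul0r.
  have [->//|/bE] := eqVneq (j.+1%:R * d) 0.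
  by rewrite -natr1 mulrDl mul1r addrK IHj add0r T0 mul0r.
by move=> x; rewrite -(divfK d_neq0 x) -[x / d]natr_Zp.
Qed.

End PrimeFieldSums.

(** * Orthogonality for the additive character *)

Section AdditiveCharacter.
Variables (R : realType) (p : nat).
Hypothesis p_prime : prime p.
Hypothesis p_gt2 : (2 < p)%N.
Local Open Scope complex_scope.
Implicit Types x y t : 'F_p.

Definition chi x : R[i] :=
  expi (- (2 * pi * (nat_of_ord x)%:R / p%:R)).

Lemma chiD x y : chi (x + y) = chi x * chi y.
Proof.
rewrite /chi -expiD -opprD -mulrDl -mulrDr -natrD -[RHS]expi_modp //.
suff -> : nat_of_ord (x + y) = ((x + y)%N %% p)%N by [].
by congr (_ %% _)%N; apply: Fp_cast.
Qed.

Lemma chi0 : chi 0 = 1.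
Proof. by rewrite /chi /= mulr0 mul0r oppr0 /expi cos0 sin0. Qed.

Lemma chi_conj x : Num.conj (chi x) = chi (- x).
Proof.
have chi_neq0 : chi x != 0.
  apply/eqP => chix0; have := chiD x (- x).
  by rewrite subrr chi0 chix0 mul0r => /eqP; rewrite oner_eq0.
by apply: (mulfI chi_neq0); rewrite expi_conj -chiD subrr chi0.
Qed.

(** The imaginary part is [- sin (2 * pi / p)], nonzero because [p > 2] puts the angle strictly
    between 0 and [pi]. *)
Lemma chi1_neq1 : chi 1 != 1.
Proof.
have p_gt0 : 0 < p%:R :> R by rewrite ltr0n prime_gt0.
have sin_gt0 : 0 < sin (2 * pi / p%:R : R).
  apply: sin_gt0_pi; rewrite divr_gt0 ?mulr_gt0 ?pi_gt0 //=.
  by rewrite ltr_pdivrMr // mulrC ltr_pM2l ?pi_gt0 // ltr_nat.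
apply/eqP => /(congr1 (@complex.Im R)) /=.
rewrite mulr1 sinN => /eqP.
by rewrite oppr_eq0 gt_eqF.
Qed.

Lemma sum_chi t : \sum_k chi (k * t) = if t == 0 then p%:R else 0.
Proof.
have [->|t_neq0] := eqVneq t 0.
  under eq_bigr => k _ do rewrite mulr0 chi0.
  by rewrite sumr_const card_Fp.
have -> : \sum_k chi (k * t) = \sum_k chi k.
  by rewrite [RHS](reindex_inj (mulIf t_neq0)).
(* Shifting the index by 1 shows that multiplication by [chi 1], which is not 1, fixes the sum. *)
apply/eqP; rewrite -[_ == 0]orFb -(negbTE chi1_neq1) -subr_eq0 -mulf_eq0.
rewrite mulrBl mul1r mulr_sumr subr_eq0 [X in _ == X](reindex_inj (addrI 1)).
by apply/eqP; apply: eq_bigr => x _; rewrite chiD.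
Qed.

End AdditiveCharacter.

(** * Diagonals of the matrix *)

Section Diagonals.
Variables (R : realType) (p : nat).
Hypothesis p_prime : prime p.
Hypothesis p_gt2 : (2 < p)%N.
Local Open Scope complex_scope.
Let U := {unit 'F_p}.
Implicit Types (f : Cvec R p) (A : 'End(Cvec R p)) (m n l : U) (d k : 'F_p).

Definition unit_vec n : Cvec R p := [ffun m => (m == n)%:R].

Definition coef A m n : R[i] := A (unit_vec n) m.

Lemma coefE A f m : A f m = \sum_n coef A m n * f n.
Proof.
have {1}-> : f = \sum_n f n *: unit_vec n.
  apply/ffunP => i; rewrite sum_ffunE (bigD1 i) //= big1 => [|n /negPf in_eq].
    by rewrite !ffunE eqxx addr0 [RHS]mulr1.
  by rewrite !ffunE eq_sym in_eq [LHS]mulr0.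
rewrite linear_sum sum_ffunE; apply: eq_bigr => n _.
by rewrite linearZ ffunE mulrC.
Qed.

Lemma coef_eq0 A : (forall m n, coef A m n = 0) -> A = 0.
Proof.
move=> A0; apply/lfunP => f; apply/ffunP => m.
by rewrite lfunE ffunE coefE big1 // => n _; rewrite A0 mul0r.
Qed.

Lemma pi0E (g : affine p) f m :
  pi0 g f m = chi R (g.1 * val m) * f (g.2 * m)%g.
Proof. by rewrite ffunE. Qed.

Lemma phi_conj m : Num.conj (phi R p m) = phi R p m.
Proof.
by rewrite ffunE; do 2!case: ifP => _; rewrite ?rmorph_nat ?rmorph0 ?rmorph1.
Qed.

Lemma pi0_phi_conj (g : affine p) m :
  Num.conj (pi0 g (phi R p) m : R[i]) =
  chi R (- (g.1 * val m)) * phi R p (g.2 * m)%g.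
Proof. by rewrite pi0E rmorphM /= phi_conj chi_conj. Qed.

Lemma measurementE A (g : affine p) :
  @Cdot R p (A (pi0 g (phi R p))) (pi0 g (phi R p)) =
  \sum_m \sum_n chi R (g.1 * (val n - val m)) *
    (coef A m n * (phi R p (g.2 * n)%g * phi R p (g.2 * m)%g)).
Proof.
apply: eq_bigr => m _; rewrite coefE mulr_suml; apply: eq_bigr => n _.
rewrite (pi0_phi_conj g m : (_ ^*)%R = _) pi0E.
rewrite mulrBr chiD // [coef _ _ _ * (_ * _)]mulrCA mulrACA.
by rewrite -(mulrA (coef A m n)).
Qed.

(** Fourier inversion: weighting the measurements at [(k, l)] by [chi (k * d)] and summing over [k]
    keeps only the pairs with [d + n - m = 0]. *)
Lemma diagonal_sum_eq0 A :
    (forall g : affine p,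
      @Cdot R p (A (pi0 g (phi R p))) (pi0 g (phi R p)) = 0) ->
  forall d l, \sum_m \sum_n (val m == val n + d)%:R *
    (coef A m n * (phi R p (l * n)%g * phi R p (l * m)%g)) = 0.
Proof.
move=> A0 d l.
have p_neq0 : p%:R != 0 :> R[i] by rewrite pnatr_eq0 -lt0n prime_gt0.
apply: (mulfI p_neq0); rewrite mulr0.
transitivity (\sum_k chi R (k * d) * @Cdot R p (A (pi0 (k, l) (phi R p)))
                                          (pi0 (k, l) (phi R p))); last first.
  by rewrite big1 // => k _; rewrite A0 mulr0.
under [RHS]eq_bigr => k _ do rewrite measurementE mulr_sumr.
rewrite [RHS]exchange_big mulr_sumr; apply: eq_bigr => m _ /=.
under [RHS]eq_bigr => k _ do rewrite mulr_sumr.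
rewrite [RHS]exchange_big mulr_sumr; apply: eq_bigr => n _ /=.
under [RHS]eq_bigr => k _ do rewrite mulrA -chiD // -mulrDr.
rewrite -mulr_suml sum_chi // [LHS]mulrA; congr (_ * _).
rewrite addrA subr_eq0 [d + _]addrC eq_sym.
by case: eqP => _; rewrite ?mulr1 ?mulr0.
Qed.

Lemma phiE m : phi R p m = (p == 3%N).+1%:R - (m == 1%g)%:R.
Proof.
rewrite ffunE -[X in val m == X]/(val (1%g : U)) (inj_eq val_inj).
by case: eqP => _; case: eqP => _; rewrite ?subrr ?subr0 // -natrB.
Qed.

Definition diag_entry A d m n : R[i] :=
  (val m == val n + d)%:R * coef A m n.

(** At most one term is nonzero. The double sum gives the extension by 0 where [x] or [x + d] is 0,
    without turning residues into units. *)
Definition diag A d (x : 'F_p) : R[i] :=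
  \sum_m \sum_n diag_entry A d m n * (val n == x)%:R.

Lemma diagE A m n : diag A (val m - val n) (val n) = coef A m n.
Proof.
rewrite /diag (bigD1 m) //= [X in _ + X]big1 ?addr0 => [|i /negPf i_neq].
  rewrite (bigD1 n) //= big1 ?addr0 => [|j /negPf j_neq].
    by rewrite /diag_entry addrC subrK !eqxx mul1r mulr1.
  by rewrite (inj_eq val_inj) j_neq mulr0.
rewrite big1 // => j _; rewrite /diag_entry (inj_eq val_inj).
have [->|_] := eqVneq j n; last by rewrite mulr0.
by rewrite addrC subrK (inj_eq val_inj) i_neq !mul0r.
Qed.

Lemma val_unit_neq0 m : val m != 0.
Proof. by rewrite -unitfE; apply: valP. Qed.

Lemma diag0 A d : diag A d 0 = 0.
Proof.
by rewrite /diag big1 // => m _; rewrite big1 // => n _;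
  rewrite (negPf (val_unit_neq0 n)) mulr0.
Qed.

Lemma diagN A d : diag A d (- d) = 0.
Proof.
rewrite /diag big1 // => m _; rewrite big1 // => n _.
rewrite /diag_entry; case: (val n =P - d) => [->|_]; last by rewrite mulr0.
by rewrite addNr (negPf (val_unit_neq0 m)) !mul0r.
Qed.

Lemma sum_diag A d : \sum_x diag A d x = \sum_m \sum_n diag_entry A d m n.
Proof.
rewrite exchange_big; apply: eq_bigr => m _ /=.
rewrite exchange_big; apply: eq_bigr => n _ /=.
rewrite -mulr_sumr (bigD1 (val n)) //= big1 ?eqxx ?addr0 ?mulr1 // => x.
by rewrite eq_sym => /negPf->.
Qed.

(** On the diagonal [m = n + d], column [x - d] is the same as row [x]. *)
Lemma diagB A d x :
  diag A d (x - d) = \sum_m \sum_n diag_entry A d m n * (val m == x)%:R.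
Proof.
apply: eq_bigr => m _; apply: eq_bigr => n _.
rewrite /diag_entry; have [->|_] := eqVneq (val m) (val n + d).
  by rewrite [_ == x - d]eq_sym subr_eq eq_sym.
by rewrite !mul0r.
Qed.

(** * Vanishing of the diagonals *)

Section ZeroMeasurements.
Variable A : 'End(Cvec R p).
Hypothesis A0 : forall g : affine p,
  @Cdot R p (A (pi0 g (phi R p))) (pi0 g (phi R p)) = 0.

Lemma diag_relation d l :
  \sum_m \sum_n diag_entry A d m n *
    (((p == 3%N).+1%:R - (n == l)%:R) * ((p == 3%N).+1%:R - (m == l)%:R)) = 0.
Proof.
rewrite -[RHS](diagonal_sum_eq0 A0 d l^-1%g).
apply: eq_bigr => m _; apply: eq_bigr => n _.
rewrite /diag_entry -mulrA !phiE.
have e i : (l^-1 * i == 1)%g = (i == l).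
  by rewrite (can2_eq (mulKVg l) (mulKg l)) mulg1.
by rewrite !e.
Qed.

Lemma diag_eq0 d x : diag A d x = 0.
Proof.
move: x (diag_relation d).
(* For [p = 3] this would fail with [c = 1], hence the separate choice of [phi] there. *)
have : ((p == 3%N).+1 * p.-1 != 2)%N.
  by have [->|] := eqVneq p 3%N; case: p p_gt2 => [|[|[|[|]]]].
have : ((p == 3%N).+1 ^ 2 * p.-1 != 2 * (p == 3%N) + 1)%N.
  by have [->|] := eqVneq p 3%N; case: p p_gt2 => [|[|[|[|]]]].
(* Now [c = k + 1] and [2 c - 1 = 2 k + 1]. *)
move: (nat_of_bool _) => k /eqP k_neq1 /eqP k_neq2 x rel; move: x.
have unitP (s : 'F_p) : s != 0 -> {l : U | val l = s}.
  by rewrite -unitfE => s_unit; exists (FinRing.unit 'F_p s_unit).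
have [d0|d_neq0] := eqVneq d 0.
  apply: (vanish_of_const p_prime _ k_neq1); rewrite ?addn1 ?diag0 //.
  move=> _ /unitP[l <-]; apply/esym/subr0_eq.
  rewrite sum_diag -[RHS](rel l) !mulr_suml.
  rewrite -sumrB; apply: eq_bigr => m _; rewrite !mulr_suml.
  rewrite -sumrB; apply: eq_bigr => n _.
  rewrite /diag_entry d0 addr0 !(inj_eq val_inj).
  (* An indicator [u] is idempotent, so [(c - u) ^ 2 = c ^ 2 - (2 c - 1) u]. *)
  have [->|_] := eqVneq m n; last by rewrite !mul0r subrr.
  by case: eqP => _ /=; ring.
apply: (vanish_of_pairs p_prime k_neq2 d_neq0); rewrite ?diag0 ?diagN //.
move=> _ /unitP[l <-]; apply/esym/subr0_eq.
(* Off the main diagonal, [rel] expands to [c] times the required relation. *)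
have k1_neq0 : k.+1%:R != 0 :> R[i] by rewrite pnatr_eq0.
apply: (mulIf k1_neq0); rewrite mul0r.
rewrite sum_diag diagB -[RHS](rel l) -big_split !mulr_suml.
rewrite -sumrB mulr_suml; apply: eq_bigr => m _ /=.
rewrite -big_split !mulr_suml -sumrB mulr_suml; apply: eq_bigr => n _ /=.
rewrite !(inj_eq val_inj).
have [ml|_] := eqVneq m l; have [nl|_] := eqVneq n l; try by rewrite /=; ring.
(* The product of the two indicators survives only for [m = n = l], which is off the diagonal since
   [d] is nonzero. *)
have -> : diag_entry A d m n = 0; last by rewrite !mul0r addr0 subr0 mul0r.
by rewrite /diag_entry ml nl eq_sym -subr_eq0 addrC addKr (negPf d_neq0) mul0r.
Qed.

End ZeroMeasurements.
End Diagonals.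

Theorem theorem6p7 (R : realType) (p : nat) (p_prime : prime p)
    (p_gt2 : (2 < p)%N) :
  does_matrix_recovery (@Cdot R p) (fun g : affine p => pi0 g (phi R p)).
Proof.
move=> A B /= AB; apply/eqP; rewrite -subr_eq0; apply/eqP.
have AB0 (g : affine p) :
    @Cdot R p ((A - B) (pi0 g (phi R p))) (pi0 g (phi R p)) = 0.
  rewrite add_lfunE opp_lfunE linearBl /=.
  by have /= -> := congr1 (@^~ g) AB; rewrite subrr.
apply: coef_eq0 => m n.
by rewrite -diagE diag_eq0.
Qed.
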